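(* Let $p$ be a prime, let $0,\alpha,\beta$ be distinct integers with $[\alpha]=[\beta]\le[\beta-\alpha]$, and let $R=\mathbb{Z}_p[x]/x(x-\alpha)(x-\beta)\mathbb{Z}_p[x]$. Then $$\zeta_R(s)=\sum_{i=1}^6\ \sum_{(r_3,r_2)\in R_i}E(r_2,r_3)\,p^{-s(r_1+r_2+r_3)},$$ where the following are subsets of $\mathbb{N}^2$: $$\begin{aligned} R_1&=\{(r_3,r_2)\mid [\beta-\alpha]+[\alpha]\le r_2 \text{ and } [\beta-\alpha]+[\alpha]\le r_3\},\\ R_2&=\{(r_3,r_2)\mid [\beta-\alpha]\le r_3,\ [\beta-\alpha]\le r_2<\min\{[\beta-\alpha]+[\alpha],r_3\}\},\\ R_3&=\{(r_3,r_2)\mid [\alpha]\le r_3<[\beta-\alpha]+[\alpha],\ r_3+[\alpha]\le r_2\},\\ R_4&=\{(r_3,r_2)\mid 0\le r_3<[\alpha],\ [\alpha]+r_3\le r_2\},\\ R_5&=\{(r_3,r_2)\mid 0\le r_3\le r_2<[\alpha]\},\\ R_6&=\{(r_3,r_2)\mid 0\le r_3<[\beta-\alpha]+[\alpha],\ \max\{[\alpha],r_3\}\le r_2<[\alpha]+r_3\}. \end{aligned}$$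
   Context: $\mathbb{N}$ contains $0$. $\mathbb{Z}_p=\{a/b\mid a,b\in\mathbb{Z},\ p\nmid b\}$ is the localization of $\mathbb{Z}$ at $p$. For nonzero $a\in\mathbb{Z}_p$, $[a]$ is the unique non-negative integer $r$ with $a\mathbb{Z}_p=p^r\mathbb{Z}_p$, and $[0]=+\infty$. $\zeta_R(s)=\sum_I |R:I|^{-s}$, where $I$ runs over the full ideals of $R$ (ideals of finite index); identities are between formal power series in $p^{-s}$. For $(r_1,r_2,r_3)\in\mathbb{N}^3$ put $S(r_2,r_3)=\{a\in\mathbb{Z}_p\mid p^{r_2}+a(\beta-\alpha)\in p^{r_3}\mathbb{Z}_p\}$, and for $a\in S(r_2,r_3)$ put $$S(r_1,r_2,r_3,a)=\{(a_1,a_2)\in\mathbb{Z}_p^2\mid p^{r_1}+\alpha a_1\in p^{r_2}\mathbb{Z}_p,\ (p^{r_2}-\alpha a)a_1+\beta p^{r_2}a_2-p^{r_1}a\in p^{r_2+r_3}\mathbb{Z}_p\}.$$ $S(r_2,r_3)$ is a (possibly empty) union of cosets of $p^{r_3}\mathbb{Z}_p$, and $\bar S(r_2,r_3)$ is the set of these cosets $\bar a=a+p^{r_3}\mathbb{Z}_p$. $S(r_1,r_2,r_3,a)$ depends only on $\bar a$ and is a (possibly empty) union of cosets of $\mathbb{Z}_p(p^{r_2},a)+\mathbb{Z}_p(0,p^{r_3})$; $\bar S(r_1,r_2,r_3,a)$ is the set of these cosets. Let $C(r_2,r_3,a)=\{r_1\in\mathbb{N}\mid \bar S(r_1,r_2,r_3,a)\ne\emptyset\}$.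 The operator $E(r_2,r_3)=\sum_{\bar a\in\bar S(r_2,r_3)}\sum_{r_1\in C(r_2,r_3,a)}|\bar S(r_1,r_2,r_3,a)|$ is understood by $$E(r_2,r_3)\,p^{-s(r_1+r_2+r_3)}=\sum_{\bar a\in\bar S(r_2,r_3)}\ \sum_{r_1\in C(r_2,r_3,a)}|\bar S(r_1,r_2,r_3,a)|\,p^{-s(r_1+r_2+r_3)}.$$ *)

(* Defs.v *)
From HB Require Import structures.
From mathcomp Require Import all_boot all_order all_algebra.
From mathcomp Require Import finmap.
From mathcomp Require Import boolp classical_sets functions cardinality fsbigop.

Set Implicit Arguments.
Unset Strict Implicit.
Unset Printing Implicit Defensive.

Import GRing.Theory.

Local Open Scope classical_set_scope.
Local Open Scope ring_scope.

Definition Zloc_pred (p : nat) (p_pr : prime p) : {pred rat} :=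
  fun q => `[< exists a b : int, ~~ (p%:Z %| b)%Z /\ q = a%:~R / b%:~R >].

(* The localization of Z at p.  The proof of primality is a parameter because
   the predicate above need not be closed under the ring operations when p is
   composite. *)
Record Zloc (p : nat) (p_pr : prime p) :=
  ZLoc { Zloc_val :> rat; _ : Zloc_val \in Zloc_pred p_pr }.

Lemma Zloc_subring_closed (p : nat) (p_pr : prime p) :
  subring_closed (Zloc_pred p_pr).
Proof.
have nd b : ~~ (p%:Z %| b)%Z -> b%:~R != 0 :> rat.
  by move=> nb; rewrite intr_eq0; apply: contraNneq nb => ->; rewrite dvdz0.
have ndM b d : ~~ (p%:Z %| b)%Z -> ~~ (p%:Z %| d)%Z -> ~~ (p%:Z %| b * d)%Z.
  by rewrite !dvdzE abszM /= Euclid_dvdM // negb_or => -> ->.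
split=> [|x y /asboolP[a [b [nb ->]]] /asboolP[c [d [nd' ->]]]
        |x y /asboolP[a [b [nb ->]]] /asboolP[c [d [nd' ->]]]]; apply/asboolP.
- exists 1, 1; split; last by rewrite divr1.
  by rewrite dvdzE /= dvdn1 neq_ltn prime_gt1 ?orbT.
- exists (a * d - c * b), (b * d); split; first exact: ndM.
  by rewrite -mulNr addf_div ?nd // rmorphB !rmorphM /= mulNr.
- exists (a * c), (b * d); split; first exact: ndM.
  by rewrite mulf_div !rmorphM.
Qed.

HB.instance Definition _ (p : nat) (p_pr : prime p) :=
  GRing.isSubringClosed.Build rat (Zloc_pred p_pr) (Zloc_subring_closed p_pr).
HB.instance Definition _ (p : nat) (p_pr : prime p) :=
  [isSub for @Zloc_val p p_pr].
HB.instance Definition _ (p : nat) (p_pr : prime p) :=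
  [Choice of Zloc p_pr by <:].
HB.instance Definition _ (p : nat) (p_pr : prime p) :=
  [SubChoice_isSubComNzRing of Zloc p_pr by <:].

(* 0 when A is infinite *)
Definition ncard (T : choiceType) (A : set T) : nat := #|` fset_set A|.

(* The cosets x + H for x in A; when A is a union of cosets of H, these are
   the cosets of H contained in A. *)
Definition cosets (V : zmodType) (H A : set V) : set (set V) :=
  [set [set x + h | h in H] | x in A].

Section Zeta.
Variable R : comNzRingType.

(* Unlike idealr_closed, this does not exclude the unit ideal. *)
Definition is_ideal (I : set R) : Prop :=
  [/\ I 0, (forall x y, I x -> I y -> I (x + y))
    & (forall a x, I x -> I (a * x))].

Definition full_ideal (I : set R) : Prop :=
  is_ideal I /\ finite_set (cosets I setT).

Definition ideal_index (I : set R) : nat := ncard (cosets I setT).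

Definition full_ideals_of_index (m : nat) : set (set R) :=
  [set I | full_ideal I /\ ideal_index I = m].

(* The coefficient of m^{-s} in zeta_R(s). *)
Definition zeta_coef (m : nat) : nat := ncard (full_ideals_of_index m).

End Zeta.

Arguments full_ideals_of_index : clear implicits.

Section Series.
Variables (p : nat) (p_pr : prime p).
Local Notation Zp := (Zloc p_pr).

(* [a] for a <> 0; the convention [0] = +oo is not needed. *)
Definition vp (a : Zp) : nat :=
  xget 0%N [set r : nat | range ( *%R a) = range ( *%R (p%:R ^+ r : Zp))].

Variables alpha beta : int.
Local Notation a_ := (alpha%:~R : Zp).
Local Notation b_ := (beta%:~R : Zp).

(* p^r Z_p *)
Definition ppow_ideal (r : nat) : set Zp := range ( *%R (p%:R ^+ r)).

Definition cubic : {poly Zp} := 'X * ('X - a_%:P) * ('X - b_%:P).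

(* As cubic is monic of size 4, the modulus mk_monic cubic used by the quotient
   is cubic itself. *)
Definition Rcubic : comNzRingType := {poly %/ cubic}.

Definition S2 (r2 r3 : nat) : set Zp :=
  [set a | ppow_ideal r3 (p%:R ^+ r2 + a * (b_ - a_))].

Definition S2bar (r2 r3 : nat) : set (set Zp) :=
  cosets (ppow_ideal r3) (S2 r2 r3).

Definition S3 (r1 r2 r3 : nat) (a : Zp) : set (Zp * Zp)%type :=
  [set u | ppow_ideal r2 (p%:R ^+ r1 + a_ * u.1) /\
           ppow_ideal (r2 + r3)
             ((p%:R ^+ r2 - a_ * a) * u.1 + b_ * p%:R ^+ r2 * u.2
              - p%:R ^+ r1 * a)].

(* Z_p (p^r2, a) + Z_p (0, p^r3) *)
Definition lat (r2 r3 : nat) (a : Zp) : set (Zp * Zp)%type :=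
  [set u | exists c d : Zp, u = (c * p%:R ^+ r2, c * a + d * p%:R ^+ r3)].

Definition S3bar (r1 r2 r3 : nat) (a : Zp) : set (set (Zp * Zp)%type) :=
  cosets (lat r2 r3 a) (S3 r1 r2 r3 a).

Definition Cset (r2 r3 : nat) (a : Zp) : set nat :=
  [set r1 | S3bar r1 r2 r3 a !=set0].

(* A representative of a (nonempty) coset.  S3bar r1 r2 r3 a depends only on
   the coset of a, so the choice is immaterial. *)
Definition repr (A : set Zp) : Zp := xget 0 A.

(* The coefficient of p^{-sn} in E(r2, r3) p^{-s(r1 + r2 + r3)}. *)
Definition E_coef (r2 r3 n : nat) : nat :=
  \sum_(A \in S2bar r2 r3) \sum_(r1 \in Cset r2 r3 (repr A))
    (ncard (S3bar r1 r2 r3 (repr A)) * (r1 + r2 + r3 == n))%N.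

End Series.

(* The sets R_1, ..., R_6 of pairs (r3, r2), with va = [alpha] and
   vd = [beta - alpha]. *)
Definition region (va vd i : nat) : set (nat * nat)%type :=
  [set r | let: (r3, r2) := r in
    match i with
    | 1 => [/\ vd + va <= r2 & vd + va <= r3]
    | 2 => [/\ vd <= r3, vd <= r2 & r2 < minn (vd + va) r3]
    | 3 => [/\ va <= r3, r3 < vd + va & r3 + va <= r2]
    | 4 => [/\ 0 <= r3, r3 < va & va + r3 <= r2]
    | 5 => [/\ 0 <= r3, r3 <= r2 & r2 < va]
    | 6 => [/\ 0 <= r3, r3 < vd + va, maxn va r3 <= r2 & r2 < va + r3]
    | _ => False
    end%N].

(* Main.v *)
(** Give R the Z_p-basis 1, x, x(x - alpha). A submodule of finite index is the
    row lattice of a unique upper triangular matrix with rows (p^r1, a1, a2),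
    (0, p^r2, a), (0, 0, p^r3), where a is taken modulo p^r3 and (a1, a2) modulo
    Z_p (p^r2, a) + Z_p (0, p^r3); its index is p^(r1 + r2 + r3). It is an ideal
    exactly when it is stable under multiplication by x, and applying x to the
    three rows turns this into the two conditions defining S(r2, r3) and
    S(r1, r2, r3, a). Hence zeta_R is the sum of E(r2, r3) p^{-s(r1 + r2 + r3)}
    over all (r3, r2) in N^2. Finally S(r2, r3) is empty unless
    [beta - alpha] <= r2 or r3 <= r2, and R_1, ..., R_6 are disjoint and cover
    all pairs satisfying this. *)
Require Import Defs.
From HB Require Import structures.
From mathcomp Require Import all_boot all_order all_algebra.
From mathcomp Require Import finmap.
From mathcomp Require Import boolp classical_sets functions cardinality fsbigop.
From mathcomp Require Import ring zify.

Set Implicit Arguments.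
Unset Strict Implicit.
Unset Printing Implicit Defensive.

Import Order.TTheory GRing.Theory Num.Theory.

Local Open Scope classical_set_scope.
Local Open Scope ring_scope.

(** * Arithmetic of Z_(p) *)

Section Zloc_arithmetic.
Variables (p : nat) (p_pr : prime p).
Local Notation Zp := (Zloc p_pr).
Local Notation P r := ((p%:R : Zp) ^+ r).

Lemma Zloc_intr_inj : injective (fun n : int => n%:~R : Zp).
Proof. by move=> m n /(congr1 val); rewrite !rmorph_int => /intr_inj. Qed.

Lemma Zloc_frac (z : Zp) :
  exists a b : int, ~~ (p%:Z %| b)%Z /\ b%:~R * z = a%:~R.
Proof.
have /asboolP[a [b [nb zE]]] := valP z.
exists a, b; split=> //; apply: val_inj.
rewrite rmorphM !rmorph_int /= zE mulrC divfK // intr_eq0.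
by apply: contraNneq nb => ->; rewrite dvdz0.
Qed.

Lemma Zloc_int_unit (b : int) :
  ~~ (p%:Z %| b)%Z -> exists c : Zp, b%:~R * c = 1.
Proof.
move=> nb.
have h : (1 / b%:~R : rat) \in Zloc_pred p_pr.
  by apply/asboolP; exists 1, b.
exists (ZLoc h); apply: val_inj; rewrite rmorphM rmorph_int rmorph1 /=.
rewrite mul1r divff // intr_eq0.
by apply: contraNneq nb => ->; rewrite dvdz0.
Qed.

Lemma Zloc_mulfI (x y z : Zp) : x != 0 -> x * y = x * z -> y = z.
Proof.
move=> x0 /(congr1 val); rewrite !rmorphM => /mulfI e; apply/val_inj/e.
by apply: contra_neq x0 => e0; apply: val_inj; rewrite e0 rmorph0.
Qed.

Lemma pexpr_neq0 r : P r != 0.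
Proof.
have -> : P r = (p ^ r)%:Z%:~R by rewrite -natrX.
apply/eqP => /(@Zloc_intr_inj (p ^ r)%:Z 0) [] /eqP.
by rewrite -[_ == _]negbK -lt0n expn_gt0 prime_gt0.
Qed.

(** Pull the power of p out of the numerator of [z]; the remaining factor, a sign times an integer
    prime to p over a denominator prime to p, is a unit, recorded with its inverse [u']. *)
Lemma Zloc_factor (z : Zp) :
  z != 0 -> exists r (u u' : Zp), u * u' = 1 /\ z = u * P r.
Proof.
move=> z0; have [a [b [nb bz]]] := Zloc_frac z.
have [c bc] := Zloc_int_unit nb.
have zE : z = c * a%:~R by rewrite -bz mulrA (mulrC c) bc mul1r.
have a0 : (0 < `|a|)%N.
  by rewrite absz_gt0; apply: contra_neq z0 => a0; rewrite zE a0 mulr0.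
have [m /[swap] aE pm] := pfactor_coprime p_pr a0.
have [m' mm'] : exists m' : Zp, m%:~R * m' = 1.
  by apply: Zloc_int_unit; rewrite dvdzE /= -prime_coprime.
exists (logn p `|a|), (c * (sgz a)%:~R * m%:R), (b%:~R * (sgz a)%:~R * m').
split.
  have ss : ((sgz a)%:~R * (sgz a)%:~R : Zp) = 1.
    by rewrite -rmorphM /= mulz_sg -absz_gt0 a0.
  transitivity ((b%:~R * c) * ((sgz a)%:~R * (sgz a)%:~R) * (m%:R * m')).
    by ring.
  by rewrite bc ss mm' !mulr1.
rewrite zE -!mulrA; congr (c * _).
rewrite -natrX -natrM -aE [in LHS](intEsg a) rmorphM /=.
by congr (_ * _); rewrite /= mulrz_nat.
Qed.

Lemma ppow_idealM r (x y : Zp) : ppow_ideal r y -> ppow_ideal r (x * y).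
Proof. by case=> t _ <-; exists (x * t) => //; rewrite mulrCA. Qed.

Lemma ppow_idealD r (x y : Zp) :
  ppow_ideal r x -> ppow_ideal r y -> ppow_ideal r (x + y).
Proof. by move=> [s _ <-] [t _ <-]; exists (s + t) => //; rewrite mulrDr. Qed.

Lemma ppow_idealN r (x : Zp) : ppow_ideal r x -> ppow_ideal r (- x).
Proof. by move=> [s _ <-]; exists (- s) => //; rewrite mulrN. Qed.

Lemma ppow_ideal_pexpr r s : (r <= s)%N -> ppow_ideal r (P s).
Proof. by move=> rs; exists (P (s - r)) => //; rewrite -exprD subnKC. Qed.

(** Clearing the denominator of the quotient, which is prime to p, gives a divisibility in Z, and
    Gauss's lemma removes that denominator. *)
Lemma ppow_ideal_natr r k : ppow_ideal r (k%:R : Zp) -> (p ^ r %| k)%N.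
Proof.
case=> z _ zE; have [a [b [nb bz]]] := Zloc_frac z.
have e : k%:Z * b = (p ^ r)%:Z * a.
  apply: Zloc_intr_inj; rewrite !rmorphM /= -bz.
  have -> : k%:Z%:~R = k%:R :> Zp by [].
  have -> : (p ^ r)%:Z%:~R = P r :> Zp by rewrite -natrX.
  by rewrite -zE; ring.
have : ((p ^ r)%:Z %| k%:Z * b)%Z by rewrite e dvdz_mulr.
rewrite dvdzE abszM /= Gauss_dvdl //.
by apply: coprimeXl; rewrite prime_coprime.
Qed.

(** A denominator prime to p is invertible modulo p^r, so every residue class of Z_p modulo p^r
    contains an integer. *)
Lemma ppow_ideal_residue r (z : Zp) :
  exists2 k, (k < p ^ r)%N & ppow_ideal r (z - k%:R).
Proof.
have [a [b [nb bz]]] := Zloc_frac z.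
have [c bc] := Zloc_int_unit nb.
have cop : coprimez b (p ^ r)%:Z.
  by rewrite coprimezE /= coprime_sym; apply: coprimeXl; rewrite prime_coprime.
have [u [v uv]] := Bezoutz b (p ^ r)%:Z.
have {}uv : u * b + v * (p ^ r)%:Z = 1 by rewrite uv; apply/eqP.
have pr0 : (p ^ r)%:Z != 0 by rewrite -lt0n expn_gt0 prime_gt0.
exists `|((u * a) %% (p ^ r)%:Z)%Z|%N.
  by rewrite -ltz_nat gez0_abs ?modz_ge0 // ltz_pmod // ltz_nat expn_gt0 prime_gt0.
have -> : (`|((u * a) %% (p ^ r)%:Z)%Z|%N%:R : Zp) = ((u * a) %% (p ^ r)%:Z)%Z%:~R.
  by rewrite -[in RHS](gez0_abs (modz_ge0 _ pr0)).
(* The Bezout relation [u * b + v * p^r = 1], multiplied by [z], shows that [z] is congruent to the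
   integer [u * a] modulo p^r. *)
have zE : z = u%:~R * a%:~R + (p ^ r)%:Z%:~R * (v%:~R * z).
  have e : (1 : Zp) = u%:~R * b%:~R + v%:~R * (p ^ r)%:Z%:~R.
    by rewrite -!rmorphM -rmorphD /= uv.
  by rewrite -bz -[LHS]mul1r {1}e; ring.
exists (((u * a) %/ (p ^ r)%:Z)%Z%:~R + v%:~R * z) => //.
have {1}-> : P r = (p ^ r)%:Z%:~R by rewrite -natrX.
rewrite {2}zE -rmorphM /= {2}(divz_eq (u * a) (p ^ r)%:Z) rmorphD rmorphM /=.
by ring.
Qed.

(** Up to a unit, each nonzero element of [I] is a power of p, which then lies in [I] too; so the
    least such power generates [I]. The element [z] excludes the zero ideal. *)
Lemma ppow_ideal_minimal (I : set Zp) (z : Zp) :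
    I z -> z != 0 -> (forall x y, I x -> I y -> I (x + y)) ->
    (forall c x, I x -> I (c * x)) ->
  exists r, I = ppow_ideal r.
Proof.
move=> Iz z0 ID IM.
have key y : I y -> y != 0 -> exists2 s, I (P s) & ppow_ideal s y.
  move=> Iy y0; have [s [u [u' [uu yE]]]] := Zloc_factor y0.
  exists s; last by exists u => //; rewrite yE mulrC.
  have -> : P s = u' * y by rewrite yE mulrA (mulrC u') uu mul1r.
  exact: IM.
have ex : exists s, `[< I (P s) >].
  by have [s Is _] := key z Iz z0; exists s; apply/asboolP.
case: (ex_minnP ex) => r /asboolP Ir rmin; exists r; apply/seteqP; split=> y.
  have [->|y0 Iy] := eqVneq y 0; first by exists 0 => //; rewrite mulr0.
  have [s Is [t _ <-]] := key y Iy y0.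
  have /rmin rs : `[< I (P s) >] by apply/asboolP.
  exists (P (s - r) * t) => //; by rewrite mulrA -exprD subnKC.
by case=> t _ <-; rewrite mulrC; apply: IM.
Qed.

Lemma ppow_ideal_le r s : ppow_ideal r (P s) -> (r <= s)%N.
Proof.
by rewrite -natrX => /ppow_ideal_natr; rewrite dvdn_Pexp2l // prime_gt1.
Qed.

(** The factorization of [z] supplies an exponent, so the [xget] in [vp] never falls back on its
    default. *)
Lemma vp_range (z : Zp) :
  z != 0 -> range ( *%R z) = ppow_ideal (vp z).
Proof.
move=> z0; rewrite /vp; case: xgetP => [r _ -> //|none].
have [r [u [u' [uu zE]]]] := Zloc_factor z0; case: (none r).
apply/seteqP; split=> _ [t _ <-].
  by exists (u * t) => //; rewrite zE; ring.
exists (u' * t) => //; rewrite zE -[RHS]mul1r -uu; ring.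
Qed.

End Zloc_arithmetic.

(** * Cardinality *)

Section Cardinality.

(** Equipotent sets are infinite together, and then both counts are 0 by convention. *)
Lemma ncard_eq (T U : choiceType) (A : set T) (B : set U) :
  (A #= B)%card -> ncard A = ncard B.
Proof.
move=> AB; rewrite /ncard; have [[n Bn]|Binf] := pselect (finite_set B).
  by rewrite (card_fset_set Bn) (card_fset_set (card_eq_trans AB Bn)).
have Ainf : ~ finite_set A by rewrite (eq_finite_set AB).
by rewrite /fset_set; do 2 case: pselect => //.
Qed.

Lemma ncard_image (T U : choiceType) (f : T -> U) (A : set T) :
  {in A &, injective f} -> ncard (f @` A) = ncard A.
Proof. by move=> /inj_card_eq /ncard_eq. Qed.

Lemma ncard_set0 (T : choiceType) : ncard (@set0 T) = 0%N.
Proof. by rewrite /ncard fset_set0 cardfs0. Qed.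

Lemma ncard_II n : ncard `I_n = n.
Proof. by apply: card_fset_set; apply: card_eqxx. Qed.

(** Turns a count of nested data into an iterated sum. Only finitely many fibres are nonempty, so
    the sum has finite support even when [Q] is infinite. *)
Lemma ncard_dep_pair (T U : choiceType) (Q : set T) (F : T -> set U) :
    finite_set [set x : T * U | Q x.1 /\ F x.1 x.2] ->
  ncard [set x : T * U | Q x.1 /\ F x.1 x.2] = \sum_(t \in Q) ncard (F t).
Proof.
set X := [set x | _] => fX.
(* [D] consists of the [t] in [Q] whose fibre is nonempty. *)
pose D := fset_set (fst @` X).
have fD : finite_set (fst @` X) by exact: finite_image.
have DQ t : t \in D -> Q t.
  by rewrite /D in_fset_set // inE => -[[t' u] [/= Qt _] <-].
have FD t u : Q t -> F t u -> t \in D.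
  by move=> Qt Ftu; rewrite /D in_fset_set // inE; exists (t, u).
have fF t : Q t -> finite_set (F t).
  move=> Qt; apply: sub_finite_set (finite_image snd fX) => u Ftu.
  by exists (t, u).
rewrite (_ : \sum_(t \in Q) _ = \sum_(t <- D) ncard (F t)); last first.
  rewrite (fsbigE (enum_fset D)) //.
  - rewrite big_seq_cond [RHS]big_seq; apply: eq_bigl => t.
    by case tD: (t \in D) => //=; rewrite mem_set //; apply: DQ.
  - move=> t Qt tD; rewrite (_ : F t = set0) ?ncard_set0 //.
    by apply/seteqP; split=> u // /(FD _ _ Qt); rewrite (negPf tD).
have -> : ncard X = size [seq (t, u) | t <- D, u <- fset_set (F t)].
  apply/perm_size/uniq_perm; first exact: fset_uniq.
    apply: allpairs_uniq_dep => [|t _|[t u] [t' u'] _ _ []]; try exact: fset_uniq.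
    by move=> <- <-.
  move=> [t u]; rewrite in_fset_set //; apply/idP/allpairsPdep => [|[t' [u' []]]].
    rewrite inE => -[/= Qt Ftu]; exists t, u; split=> //; first exact: FD Ftu.
    by rewrite in_fset_set ?inE //; apply: fF.
  move=> /DQ Qt; rewrite in_fset_set ?inE => [Ftu [-> ->] //|]; exact: fF.
by rewrite size_allpairs_dep sumnE big_map.
Qed.

Lemma ncard_setX (T U : choiceType) (A : set T) (B : set U) :
  finite_set A -> finite_set B -> ncard (A `*` B) = (ncard A * ncard B)%N.
Proof.
move=> fA fB.
rewrite (ncard_dep_pair (F := fun=> B)); last exact: (finite_setX fA fB).
by rewrite fsbig_finite // big_const_seq count_predT iter_addr_0 -mulr_natl natn.
Qed.

End Cardinality.

(** * Lattices in Z_(p)^3 *)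

Section Cosets.
Variable V : zmodType.

Definition is_subgroup (H : set V) : Prop :=
  H 0 /\ forall x y, H x -> H y -> H (x - y).

Lemma coset_eqP (H : set V) (x y : V) : is_subgroup H ->
  [set x + h | h in H] = [set y + h | h in H] <-> H (x - y).
Proof.
move=> [H0 HB]; split=> [e|Hxy].
  have [h Hh <-] : [set y + h | h in H] x by rewrite -e; exists 0; rewrite ?addr0.
  by rewrite addrC addKr.
have HN z : H z -> H (- z) by move=> Hz; rewrite -sub0r; apply: HB.
apply/seteqP; split=> _ [h Hh <-].
  exists (h - (y - x)); last by rewrite opprB addrCA subrKC addrC.
  by apply: HB => //; rewrite -opprB; apply: HN.
exists (h - (x - y)); first exact: HB.
by rewrite opprB addrCA subrKC addrC.
Qed.

(** Pigeonhole: two of the infinitely many multiples of [v] share a coset, and their difference lies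
    in [H]. *)
Lemma finite_index_mulrn (H : set V) (v : V) :
    is_subgroup H -> finite_set (cosets H setT) ->
  exists2 n, (0 < n)%N & H (v *+ n).
Proof.
move=> subH fH; pose f n := [set v *+ n + h | h in H].
have : ~ {in setT &, injective f}.
  move=> /inj_card_eq /eq_finite_set e; apply: infinite_nat; rewrite -e.
  by apply: sub_finite_set fH => _ [n _ <-]; exists (v *+ n).
apply: contra_notP => none m n _ _ /(coset_eqP _ _ subH).
wlog mn : m n / (n <= m)%N.
  by move=> wlg; case: (leqP n m) => [/wlg//|/ltnW /wlg + Hmn]; move=> ->//;
    rewrite -opprB -sub0r; case: subH => H0; apply.
move=> Hmn; apply/eqP; rewrite eqn_leq mn andbT leqNgt; apply/negP => nm.
by apply: none; exists (m - n)%N; rewrite ?subn_gt0 // mulrnBr.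
Qed.

End Cosets.

Section Lattices.
Variables (p : nat) (p_pr : prime p).
Local Notation Zp := (Zloc p_pr).
Local Notation P r := ((p%:R : Zp) ^+ r).
Local Notation V := (Zp * Zp * Zp)%type.

Lemma add_tripleE (v w : V) :
  v + w = (v.1.1 + w.1.1, v.1.2 + w.1.2, v.2 + w.2).
Proof. by []. Qed.

Lemma sub_tripleE (v w : V) :
  v - w = (v.1.1 - w.1.1, v.1.2 - w.1.2, v.2 - w.2).
Proof. by []. Qed.

Definition is_submodule (J : set V) : Prop :=
  [/\ J 0, (forall v w, J v -> J w -> J (v + w))
    & (forall c v, J v -> J (c * v.1.1, c * v.1.2, c * v.2))].

Lemma submodule_subgroup (J : set V) : is_submodule J -> is_subgroup J.
Proof.
move=> [J0 JD JM]; split=> // v w Jv Jw; apply: JD => //.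
have := JM (-1) w Jw; rewrite !mulN1r; by case: w {Jw} => [[? ?] ?].
Qed.

(* [case] on such an equation would also decompose [0 : Zp]. *)
Lemma triple_inj (T1 T2 T3 : Type) (x x' : T1) (y y' : T2) (z z' : T3) :
  (x, y, z) = (x', y', z') -> [/\ x = x', y = y' & z = z'].
Proof. by move=> e; split; [move: (congr1 (fun t => t.1.1) e)|
  move: (congr1 (fun t => t.1.2) e)|move: (congr1 snd e)]. Qed.

Arguments triple_inj {T1 T2 T3 x x' y y' z z'} _.

(** The row lattice: [x], [y], [z] are the coefficients of the three rows of the triangular
    matrix. *)
Definition hermite (r1 r2 r3 : nat) (a : Zp) (u : Zp * Zp) : set V :=
  [set v | exists x y z : Zp,
     v = (x * P r1, x * u.1 + y * P r2, x * u.2 + y * a + z * P r3)].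

Lemma hermite_submodule r1 r2 r3 a u : is_submodule (hermite r1 r2 r3 a u).
Proof.
split=> [|_ _ [x [y [z ->]]] [x' [y' [z' ->]]]|c _ [x [y [z ->]]]].
- by exists 0, 0, 0; rewrite !mul0r !addr0.
- by exists (x + x'), (y + y'), (z + z'); congr (_, _, _) => /=; ring.
- by exists (c * x), (c * y), (c * z); congr (_, _, _) => /=; ring.
Qed.

Lemma pexpr_mul_eq0 r (x : Zp) : x * P r = 0 -> x = 0.
Proof.
move=> e; apply: (Zloc_mulfI (pexpr_neq0 p_pr r)).
by rewrite mulr0 mulrC.
Qed.

(** Each row of the first matrix is expressed in the rows of the second. Its leading zeros kill the
    coefficients of the earlier rows, and its leading entry then gives the inequality of
    exponents. *)
Lemma hermite_sub r1 r2 r3 a u s1 s2 s3 b w :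
    hermite r1 r2 r3 a u `<=` hermite s1 s2 s3 b w ->
  [/\ s1 <= r1, s2 <= r2 & s3 <= r3]%N.
Proof.
move=> sub.
have [|x [y [z /triple_inj[e1 _ _]]]] := sub (P r1, u.1, u.2).
  by exists 1, 0, 0; congr (_, _, _) => /=; ring.
have [|x' [y' [z' /triple_inj[/esym/pexpr_mul_eq0 -> e2 _]]]] := sub (0, P r2, a).
  by exists 0, 1, 0; congr (_, _, _) => /=; ring.
have [|x'' [y'' [z'' /triple_inj[/esym/pexpr_mul_eq0 -> + e3]]]] := sub (0, 0, P r3).
  by exists 0, 0, 1; congr (_, _, _) => /=; ring.
rewrite mul0r add0r => /esym/pexpr_mul_eq0 y0.
move: e2 e3; rewrite y0 !mul0r !add0r => e2 e3.
split.
- by apply: (@ppow_ideal_le _ p_pr); exists x; rewrite // mulrC.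
- by apply: (@ppow_ideal_le _ p_pr); exists y'; rewrite // mulrC.
- by apply: (@ppow_ideal_le _ p_pr); exists z''; rewrite // mulrC.
Qed.

(** Uniqueness of the Hermite form. Once the exponents agree, a row of one matrix uses the
    corresponding row of the other with coefficient 1; the coefficients of the later rows are the
    two congruences. *)
Lemma hermite_eqP r1 r2 r3 a u s1 s2 s3 b w :
  hermite r1 r2 r3 a u = hermite s1 s2 s3 b w <->
  [/\ r1 = s1, r2 = s2, r3 = s3, ppow_ideal r3 (a - b) & lat r2 r3 b (u - w)].
Proof.
split=> [e|[<- <- <- [t _ ab] [c [d uw]]]].
  have /hermite_sub[r1s r2s r3s] :
    hermite r1 r2 r3 a u `<=` hermite s1 s2 s3 b w by rewrite e.
  have /hermite_sub[s1r s2r s3r] :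
    hermite s1 s2 s3 b w `<=` hermite r1 r2 r3 a u by rewrite e.
  have E1 : r1 = s1 by apply/eqP; rewrite eqn_leq r1s s1r.
  have E2 : r2 = s2 by apply/eqP; rewrite eqn_leq r2s s2r.
  have E3 : r3 = s3 by apply/eqP; rewrite eqn_leq r3s s3r.
  subst s1 s2 s3; split=> //.
    have : hermite r1 r2 r3 b w (0, P r2, a).
      by rewrite -e; exists 0, 1, 0; congr (_, _, _) => /=; ring.
    move=> [x [y [z /triple_inj[/esym/pexpr_mul_eq0 -> + +]]]].
    rewrite !mul0r !add0r => /esym h; have {h} y1 : y = 1.
      apply: (Zloc_mulfI (pexpr_neq0 p_pr r2)).
      by rewrite mulr1 mulrC.
    by rewrite y1 => ->; exists z => //; ring.
  have : hermite r1 r2 r3 b w (P r1, u.1, u.2).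
    by rewrite -e; exists 1, 0, 0; congr (_, _, _) => /=; ring.
  move=> [x [y [z /triple_inj[/esym h + +]]]]; have {h} x1 : x = 1.
    by apply: (Zloc_mulfI (pexpr_neq0 p_pr r1)); rewrite mulr1 mulrC.
  rewrite x1 => u1 u2; exists y, z.
  case: u w u1 u2 {e} => [u1 u2] [w1 w2] /= -> ->.
  by congr (_, _) => /=; ring.
have {}ab : a = b + P r3 * t by rewrite ab addrC subrK.
have u1 : u.1 = w.1 + c * P r2.
  by rewrite -[c * _]/(c * P r2, c * b + d * P r3).1 -uw /= addrC subrK.
have u2 : u.2 = w.2 + (c * b + d * P r3).
  by rewrite -[_ + d * _]/(c * P r2, c * b + d * P r3).2 -uw /= addrC subrK.
(* Row 1 changes by [c] times row 2 plus [d] times row 3, and row 2 by [t] times row 3; the second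
   triple of witnesses inverts this substitution. *)
apply/seteqP; split=> _ [x [y [z ->]]].
  exists x, (x * c + y), (x * d + y * t + z).
  by rewrite u1 u2 ab; congr (_, _, _) => /=; ring.
exists x, (y - x * c), (z - x * d - (y - x * c) * t).
by rewrite u1 u2 ab; congr (_, _, _) => /=; ring.
Qed.

(** The leading entries of the vectors of [J] with a given number of initial zeros form an ideal,
    made nonzero by the corresponding [c]. Lifts of generators of these ideals are the rows. *)
Lemma submodule_hermite (J : set V) (c1 c2 c3 : Zp) :
    is_submodule J -> c1 != 0 -> c2 != 0 -> c3 != 0 ->
    J (c1, 0, 0) -> J (0, c2, 0) -> J (0, 0, c3) ->
  exists r1 r2 r3 a u, J = hermite r1 r2 r3 a u.
Proof.
move=> [J0 JD JM] n1 n2 n3 Jc1 Jc2 Jc3.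
have JB v w : J v -> J w -> J (v - w).
  by have [_] := submodule_subgroup (And3 J0 JD JM); apply.
have [r3 E3] : exists r, [set z | J (0, 0, z)] = ppow_ideal r.
  apply: (ppow_ideal_minimal Jc3) => // [x y Jx Jy|c x Jx].
    by have := JD _ _ Jx Jy; rewrite add_tripleE /= !addr0.
  by have := JM c _ Jx; rewrite /= !mulr0.
have [r2 E2] : exists r, [set y | exists z, J (0, y, z)] = ppow_ideal r.
  apply: (ppow_ideal_minimal (z := c2)) => // [|x y [z Jx] [z' Jy]|c x [z Jx]].
  - by exists 0.
  - by exists (z + z'); have := JD _ _ Jx Jy; rewrite add_tripleE /= addr0.
  - by exists (c * z); have := JM c _ Jx; rewrite /= mulr0.
have [r1 E1] : exists r, [set x | exists y z, J (x, y, z)] = ppow_ideal r.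
  apply: (ppow_ideal_minimal (z := c1)) => //
    [|x y [z [w Jx]] [z' [w' Jy]]|c x [z [w Jx]]].
  - by exists 0, 0.
  - by exists (z + z'), (w + w'); have := JD _ _ Jx Jy.
  - by exists (c * z), (c * w); have := JM c _ Jx.
have J3 : J (0, 0, P r3).
  by have : [set z | J (0, 0, z)] (P r3) by rewrite E3; exists 1; rewrite ?mulr1.
have [a J2] : [set y | exists z, J (0, y, z)] (P r2).
  by rewrite E2; exists 1; rewrite ?mulr1.
have [u1 [u2 J1]] : [set x | exists y z, J (x, y, z)] (P r1).
  by rewrite E1; exists 1; rewrite ?mulr1.
exists r1, r2, r3, a, (u1, u2); apply/seteqP; split=> [[[v1 v2] v3] Jv|].
  (* Subtracting multiples of the rows clears the coordinates of [v] one after the other. *)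
  have [x _ xE] : ppow_ideal r1 v1 by rewrite -E1; exists v2, v3.
  have J' := JB _ _ Jv (JM x _ J1).
  have [y _ yE] : ppow_ideal r2 (v2 - x * u1).
    rewrite -E2; exists (v3 - x * u2); move: J'.
    by rewrite sub_tripleE /= -xE (mulrC x) subrr.
  have J'' := JB _ _ J' (JM y _ J2).
  have [z _ zE] : ppow_ideal r3 (v3 - x * u2 - y * a).
    rewrite -E3 /=; move: J''; rewrite sub_tripleE /=.
    by rewrite -xE (mulrC x) subrr mulr0 subr0 -yE (mulrC y) subrr.
  exists x, y, z; congr (_, _, _) => /=; first by rewrite -xE mulrC.
    by rewrite (mulrC y) yE; ring.
  by rewrite (mulrC z) zE; ring.
move=> _ [x [y [z ->]]].
have := JD _ _ (JD _ _ (JM x _ J1) (JM y _ J2)) (JM z _ J3).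
by rewrite add_tripleE /= !mulr0 !addr0.
Qed.

(** The integer vectors in the box with sides p^r1, p^r2, p^r3 represent each coset exactly once. *)
Lemma cosets_hermite r1 r2 r3 a u :
  finite_set (cosets (hermite r1 r2 r3 a u) setT) /\
  ncard (cosets (hermite r1 r2 r3 a u) setT) = (p ^ (r1 + r2 + r3))%N.
Proof.
set H := hermite _ _ _ _ _.
have subH : is_subgroup H by apply/submodule_subgroup/hermite_submodule.
pose B := `I_(p ^ r1) `*` `I_(p ^ r2) `*` `I_(p ^ r3).
have fB : finite_set B by do 2?apply: finite_setX.
pose g (t : nat * nat * nat) :=
  [set (t.1.1%:R, t.1.2%:R, t.2%:R) + h | h in H].
have natr_inj r i j : (i < p ^ r)%N -> (j < p ^ r)%N ->
    ppow_ideal r (i%:R - j%:R : Zp) -> i = j.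
  wlog ij : i j / (j <= i)%N.
    move=> wlg ir jr; case: (leqP j i) => [|/ltnW] ij h; first exact: wlg.
    by apply/esym/wlg => //; rewrite -opprB; apply: ppow_idealN.
  move=> ir jr; rewrite -natrB // => /ppow_ideal_natr.
  move: ir jr ij; case: (posnP (i - j)) => [|d0]; first by lia.
  by move=> ir jr ij /(dvdn_leq d0); lia.
have g_inj : {in B &, injective g}.
  move=> [[i j] k] [[i' j'] k'] /set_mem[[/= iB jB] kB] /set_mem[[/= iB' jB'] kB'].
  move=> /(coset_eqP _ _ subH) [x [y [z]]].
  rewrite sub_tripleE /= => /triple_inj[e1 e2 e3].
  (* Coordinates are compared from left to right: equality in one kills the coefficient of its row,
     which isolates the next. *)
  have ii : i = i' by apply: (natr_inj r1) => //; exists x; rewrite // e1 mulrC.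
  subst i'; move/esym: e1; rewrite subrr => /pexpr_mul_eq0 x0.
  move: e2 e3; rewrite x0 !mul0r !add0r => e2 e3.
  have jj : j = j' by apply: (natr_inj r2) => //; exists y; rewrite // e2 mulrC.
  subst j'; move/esym: e2; rewrite subrr => /pexpr_mul_eq0 y0.
  move: e3; rewrite y0 mul0r add0r => e3.
  by congr (_, _, _); apply: (natr_inj r3) => //; exists z; rewrite // e3 mulrC.
have -> : cosets H setT = g @` B.
  apply/seteqP; split=> [_ [[[v1 v2] v3] _ <-]|_ [t _ <-]];
    last by exists (t.1.1%:R, t.1.2%:R, t.2%:R).
  have [i ir [x _ xE]] := ppow_ideal_residue r1 v1.
  have [j jr [y _ yE]] := ppow_ideal_residue r2 (v2 - x * u.1).
  have [k kr [z _ zE]] := ppow_ideal_residue r3 (v3 - x * u.2 - y * a).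
  exists (i, j, k) => //; apply/(coset_eqP _ _ subH).
  exists (- x), (- y), (- z); rewrite sub_tripleE /= .
  rewrite !mulNr (mulrC x) xE (mulrC y) yE (mulrC z) zE.
  by congr (_, _, _); ring.
split; first exact: finite_image.
rewrite ncard_image // !ncard_setX ?ncard_II // ?expnD //.
exact: finite_setX.
Qed.

(** * Lattices stable under multiplication by x *)

Variables alpha beta : int.
Local Notation a_ := (alpha%:~R : Zp).
Local Notation b_ := (beta%:~R : Zp).

(* Multiplication by x in the basis 1, x, x(x - alpha). *)
Definition mulx (v : V) : V :=
  (0, v.1.1 + a_ * v.1.2, v.1.2 + b_ * v.2).

(** Row 3 is multiplied by beta. The image of row 2 minus alpha times row 2 is (0, 0, p^r2 + a(beta
    - alpha)), which gives the condition of [S2]. The image of row 1 is (0, p^r1 + alpha u1, u1 +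
    beta u2), which gives those of [S3]. *)
Lemma hermite_mulxP r1 r2 r3 a u :
  (forall v, hermite r1 r2 r3 a u v -> hermite r1 r2 r3 a u (mulx v)) <->
  S2 alpha beta r2 r3 a /\ S3 alpha beta r1 r2 r3 a u.
Proof.
split=> [stable|[[t _ tE] [[s _ sE] [t' _ t'E]]] _ [x [y [z ->]]]].
  have [|x [y [z]]] := stable (0, P r2, a).
    by exists 0, 1, 0; congr (_, _, _) => /=; ring.
  case/triple_inj=> /esym/pexpr_mul_eq0 -> + +; rewrite !mul0r !add0r /= => /esym h.
  have {h} -> : y = a_.
    by apply: (Zloc_mulfI (pexpr_neq0 p_pr r2)); rewrite mulrC h mulrC.
  move=> e; split; first exists z => //.
    transitivity (a_ * a + z * P r3 - a_ * a); first by ring.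
    by rewrite -e; ring.
  have [|x' [y' [z']]] := stable (P r1, u.1, u.2).
    by exists 1, 0, 0; congr (_, _, _) => /=; ring.
  case/triple_inj=> /esym/pexpr_mul_eq0 -> + +; rewrite !mul0r !add0r /= => e1 e2.
  split; first by exists y' => //; rewrite mulrC.
  (* The third coordinate is multiplied by p^r2, so that the coefficient [y'] of row 2 enters only
     through [y' * p^r2 = p^r1 + alpha u1]. *)
  exists z' => //; rewrite exprD.
  transitivity ((y' * a + z' * P r3) * P r2 - (y' * P r2) * a); first by ring.
  by rewrite -e2 -e1; ring.
(* Conversely, the factor p^r2 is cancelled from the second condition of [S3]. *)
have e : u.1 + b_ * u.2 = s * a + P r3 * t'.
  apply: (Zloc_mulfI (pexpr_neq0 p_pr r2)).
  transitivity ((P r2 - a_ * a) * u.1 + b_ * P r2 * u.2 - P r1 * a +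
    (P r1 + a_ * u.1) * a); first by ring.
  by rewrite -t'E -sE exprD; ring.
(* Rows 1, 2, 3 are sent to [s] row 2 + [t'] row 3, alpha row 2 + [t] row 3, and beta row 3. *)
exists 0, (x * s + y * a_), (x * t' + y * t + z * b_).
rewrite /mulx /=; congr (_, _, _); first by ring.
  transitivity (x * (P r1 + a_ * u.1) + y * a_ * P r2); first by ring.
  by rewrite -sE; ring.
transitivity (x * (u.1 + b_ * u.2) + y * (P r2 + a * (b_ - a_)) + y * a * a_ +
  z * b_ * P r3).
  by ring.
by rewrite e -tE; ring.
Qed.

End Lattices.

(** * Coordinates on R *)

Section Coordinates.
Variables (p : nat) (p_pr : prime p) (alpha beta : int).
Local Notation Zp := (Zloc p_pr).
Local Notation P r := ((p%:R : Zp) ^+ r).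
Local Notation V := (Zp * Zp * Zp)%type.
Local Notation a_ := (alpha%:~R : Zp).
Local Notation b_ := (beta%:~R : Zp).
Local Notation R := (Rcubic p_pr alpha beta).
Local Notation f := (cubic p_pr alpha beta).

Definition coords_poly (v : V) : {poly Zp} :=
  v.1.1%:P + v.1.2%:P * 'X + v.2%:P * ('X * ('X - a_%:P)).

Definition of_coords (v : V) : R := in_qpoly f (coords_poly v).

(** The middle entry is corrected because x^2 = x(x - alpha) + alpha x. *)
Definition coords (q : {poly %/ f}) : V :=
  let q := q : {poly Zp} in (q`_0, q`_1 + a_ * q`_2, q`_2).

Lemma cubic_monic : f \is monic.
Proof. by rewrite !monicMl ?monicX ?monicXsubC. Qed.

Lemma size_cubic : size f = 4.
Proof.
by rewrite !size_monicM ?monicMl ?monicX ?monicXsubC ?polyXsubC_eq0 // size_polyX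
  !size_XsubC.
Qed.

Lemma mk_monic_cubic : mk_monic f = f.
Proof. by rewrite /mk_monic size_cubic cubic_monic. Qed.

Lemma coef_coords_poly v i : (coords_poly v)`_i =
  [:: v.1.1; v.1.2 - a_ * v.2; v.2]`_i.
Proof.
rewrite /coords_poly !coefD coefC coefCM coefX coefCM coefXM.
rewrite coefB coefC coefX.
by case: i => [|[|[|i]]] //=; rewrite ?nth_nil; ring.
Qed.

Lemma of_coords_poly v : of_coords v = coords_poly v :> {poly Zp}.
Proof.
apply: in_qpoly_small; rewrite mk_monic_cubic size_cubic ltnS.
apply/leq_sizeP => i; rewrite coef_coords_poly.
by case: i => [|[|[|i]]] //= _; rewrite nth_nil.
Qed.

Lemma of_coordsK : cancel of_coords coords.
Proof.
move=> [[v1 v2] v3]; rewrite /coords of_coords_poly !coef_coords_poly /=.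
by congr (_, _, _); ring.
Qed.

Lemma coordsK : cancel coords of_coords.
Proof.
move=> q; apply: val_inj; rewrite [LHS]of_coords_poly.
apply/polyP => i; rewrite coef_coords_poly /=.
case: i => [|[|[|i]]] //=; first by ring.
rewrite nth_nil nth_default //.
rewrite -ltnS; apply: leq_trans (size_mk_monic q) _.
by rewrite mk_monic_cubic size_cubic.
Qed.

Lemma of_coords_inj : injective of_coords.
Proof. exact: can_inj of_coordsK. Qed.

Lemma of_coordsD v w : of_coords (v + w) = of_coords v + of_coords w.
Proof.
rewrite /of_coords -in_qpolyD; congr in_qpoly.
by rewrite /coords_poly add_tripleE /= !rmorphD /=; ring.
Qed.

Lemma of_coordsZ c v :
  of_coords (c * v.1.1, c * v.1.2, c * v.2) = in_qpoly f c%:P * of_coords v.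
Proof.
rewrite /of_coords -in_qpolyM; congr in_qpoly.
by rewrite /coords_poly /= !rmorphM /=; ring.
Qed.

Lemma in_qpoly_cubic : in_qpoly f f = 0.
Proof.
apply: val_inj; rewrite /= mk_monic_cubic Pdiv.RingMonic.rmodpp //.
exact: cubic_monic.
Qed.

Lemma of_coords_mulx v :
  of_coords (mulx alpha beta v) = in_qpoly f 'X * of_coords v.
Proof.
(* The two polynomials differ by [v.2] times [cubic], which is zero in R. *)
rewrite /of_coords -in_qpolyM -[LHS]addr0 -(mul0r (in_qpoly f v.2%:P)).
rewrite -in_qpoly_cubic -in_qpolyM -in_qpolyD; congr in_qpoly.
rewrite /coords_poly /mulx /cubic /= !(rmorphD, rmorphM, rmorph0) /=.
by ring.
Qed.

Lemma ideal_preimage (I : set R) : is_ideal I ->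
  is_submodule (of_coords @^-1` I) /\
  (forall v, (of_coords @^-1` I) v -> (of_coords @^-1` I) (mulx alpha beta v)).
Proof.
move=> [I0 ID IM]; split; first split.
- have e : of_coords (0 + 0) = of_coords 0 + of_coords 0 by exact: of_coordsD.
  move: e; rewrite addr0 => /eqP; rewrite addrC -subr_eq subrr => /eqP e.
  by rewrite /preimage /= -e.
- by move=> v w Jv Jw; rewrite /preimage /= of_coordsD; apply: ID.
- by move=> c v Jv; rewrite /preimage /= of_coordsZ; apply: IM.
by move=> v Jv; rewrite /preimage /= of_coords_mulx; apply: IM.
Qed.

Lemma of_coordsE v : of_coords v = in_qpoly f v.1.1%:P +
  in_qpoly f v.1.2%:P * in_qpoly f 'X +
  in_qpoly f v.2%:P * (in_qpoly f 'X * (in_qpoly f 'X - in_qpoly f a_%:P)).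
Proof. by rewrite /of_coords /coords_poly !(rmorphD, rmorphM, rmorphN). Qed.

(** Every element of R is a combination of 1, x, x(x - alpha), so stability under constants and
    under x suffices. *)
Lemma submodule_ideal (J : set V) :
    is_submodule J -> (forall v, J v -> J (mulx alpha beta v)) ->
  is_ideal (of_coords @` J).
Proof.
move=> [J0 JD JM] Jx.
have ID x y : (of_coords @` J) x -> (of_coords @` J) y -> (of_coords @` J) (x + y).
  by move=> [v Jv <-] [w Jw <-]; exists (v + w); [exact: JD|exact: of_coordsD].
have IZ c y : (of_coords @` J) y -> (of_coords @` J) (in_qpoly f c%:P * y).
  by move=> [v Jv <-]; rewrite -of_coordsZ; eexists; [exact: (JM c v Jv)|].
have IX y : (of_coords @` J) y -> (of_coords @` J) (in_qpoly f 'X * y).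
  by move=> [v Jv <-]; rewrite -of_coords_mulx; eexists; [exact: (Jx v Jv)|].
split=> // [|q y Iy].
  exists 0 => //; have := of_coordsD 0 0; rewrite addr0 => /eqP.
  by rewrite addrC -subr_eq subrr => /eqP.
rewrite -[q]coordsK of_coordsE; set v := coords q.
rewrite !mulrDl; apply: (ID); first apply: (ID); first exact: IZ.
  by rewrite -mulrA; apply/IZ/IX.
rewrite -!mulrA; apply/IZ/IX; rewrite mulrBl; apply: ID; first exact: IX.
rewrite -mulNr -rmorphN -polyCN; exact: IZ.
Qed.

(** Transfers the index of a lattice to the index of its image in R. *)
Lemma cosets_of_coords (J : set V) :
  cosets (of_coords @` J) setT = (image^~ of_coords) @` cosets J setT.
Proof.
have e v : [set of_coords v + h | h in of_coords @` J] =
    of_coords @` [set v + h | h in J].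
  apply/seteqP; split=> _ [_ [h Jh <-] <-].
    by exists (v + h); [exists h|rewrite of_coordsD].
  by exists (of_coords h); [exists h|rewrite of_coordsD].
apply/seteqP; split=> [_ [q _ <-]|_ [_ [v _ <-] <-]].
  by rewrite -[q]coordsK e; exists [set coords q + h | h in J] => //; exists (coords q).
by exists (of_coords v) => //; rewrite e.
Qed.

Lemma image_of_coords_inj : injective (image^~ of_coords).
Proof.
have key (A B : set V) : of_coords @` A = of_coords @` B -> A `<=` B.
  move=> e v Av; have : (of_coords @` B) (of_coords v) by rewrite -e; exists v.
  by move=> [w Bw /of_coords_inj <-].
by move=> A B e; apply/seteqP; split; apply: key.
Qed.

End Coordinates.

(** * Parametrization of the full ideals *)

Section Parametrization.
Variables (p : nat) (p_pr : prime p) (alpha beta : int).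
Local Notation Zp := (Zloc p_pr).
Local Notation P r := ((p%:R : Zp) ^+ r).
Local Notation V := (Zp * Zp * Zp)%type.
Local Notation a_ := (alpha%:~R : Zp).
Local Notation b_ := (beta%:~R : Zp).
Local Notation R := (Rcubic p_pr alpha beta).
Local Notation of_coords := (@of_coords p p_pr alpha beta).

Lemma hermite_index r1 r2 r3 a u :
  finite_set (cosets (of_coords @` hermite r1 r2 r3 a u) setT) /\
  ideal_index (of_coords @` hermite r1 r2 r3 a u) = (p ^ (r1 + r2 + r3))%N.
Proof.
have [fH cH] := cosets_hermite r1 r2 r3 a u.
rewrite /ideal_index cosets_of_coords; split; first exact: finite_image.
by rewrite ncard_image // => A B _ _; apply: image_of_coords_inj.
Qed.

Lemma full_idealP (I : set R) : full_ideal I <->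
  exists r1 r2 r3 a u, [/\ S2 alpha beta r2 r3 a, S3 alpha beta r1 r2 r3 a u &
    I = of_coords @` hermite r1 r2 r3 a u].
Proof.
split=> [[idI fI]|[r1 [r2 [r3 [a [u [S2a S3u ->]]]]]]]; last first.
  split; last by have [] := hermite_index r1 r2 r3 a u.
  apply: submodule_ideal; first exact: hermite_submodule.
  exact/hermite_mulxP.
have [subJ Jx] := ideal_preimage idI.
set J := of_coords @^-1` I in subJ Jx.
have IE : I = of_coords @` J.
  apply/seteqP; split=> [q Iq|_ [v Jv <-] //].
  by exists (coords q); rewrite /J /preimage /= ?coordsK.
have fJ : finite_set (cosets J setT).
  move: fI; rewrite IE cosets_of_coords (eq_finite_set (inj_card_eq _)) //.
  by move=> A B _ _; apply: image_of_coords_inj.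
have sJ := submodule_subgroup subJ.
have n0 n : (0 < n)%N -> n%:R != 0 :> Zp.
  move=> n0; apply/eqP => /(@Zloc_intr_inj _ p_pr n 0) [] n0'.
  by rewrite n0' in n0.
have mulrn_triple (v : V) n : v *+ n = (v.1.1 *+ n, v.1.2 *+ n, v.2 *+ n).
  by elim: n => [|n IHn]; rewrite ?mulr0n // !mulrS IHn add_tripleE.
(* Finite index puts a positive multiple of each basis vector in [J], nonzero in characteristic 0;
   these are the three vectors [submodule_hermite] asks for. *)
have [n1 n1_gt0] := finite_index_mulrn (1, 0, 0) sJ fJ.
have [n2 n2_gt0] := finite_index_mulrn (0, 1, 0) sJ fJ.
have [n3 n3_gt0] := finite_index_mulrn (0, 0, 1) sJ fJ.
rewrite !mulrn_triple /= !mul0rn => J3 J2 J1.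
have [r1 [r2 [r3 [a [u JE]]]]] :=
  submodule_hermite subJ (n0 _ n1_gt0) (n0 _ n2_gt0) (n0 _ n3_gt0) J1 J2 J3.
exists r1, r2, r3, a, u; rewrite JE in Jx IE.
by have [] := (hermite_mulxP alpha beta r1 r2 r3 a u).1 Jx.
Qed.

(** * Independence of the coset representatives *)

Lemma ppow_ideal_subgroup r : is_subgroup (ppow_ideal r : set Zp).
Proof.
split=> [|x y Ix Iy]; first by exists 0; rewrite ?mulr0.
by apply: ppow_idealD => //; apply: ppow_idealN.
Qed.

Lemma lat_subgroup r2 r3 (a : Zp) : is_subgroup (lat r2 r3 a).
Proof.
split=> [|_ _ [c [d ->]] [c' [d' ->]]]; first by exists 0, 0; rewrite !mul0r addr0.
exists (c - c'), (d - d').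
transitivity (c * P r2 - c' * P r2, (c * a + d * P r3) - (c' * a + d' * P r3)) => //.
by congr (_, _); ring.
Qed.

Lemma S2_coset r2 r3 (a b : Zp) : ppow_ideal r3 (a - b) ->
  S2 alpha beta r2 r3 a -> S2 alpha beta r2 r3 b.
Proof.
move=> ab S2a; rewrite /S2 /=.
rewrite (_ : _ + _ = (P r2 + a * (b_ - a_)) + (a_ - b_) * (a - b)); last by ring.
by apply: ppow_idealD => //; apply: ppow_idealM.
Qed.

(** Both sets of parameters define the same lattice, and by [hermite_mulxP] the conditions on them
    express its stability under x. *)
Lemma S3_coset r1 r2 r3 (a b : Zp) (u w : Zp * Zp) :
    ppow_ideal r3 (a - b) -> lat r2 r3 b (u - w) ->
    S2 alpha beta r2 r3 a -> S3 alpha beta r1 r2 r3 a u ->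
  S3 alpha beta r1 r2 r3 b w.
Proof.
move=> ab uw S2a S3u.
have := (hermite_mulxP alpha beta r1 r2 r3 a u).2 (conj S2a S3u).
have -> : hermite r1 r2 r3 a u = hermite r1 r2 r3 b w by apply/hermite_eqP.
by move=> /hermite_mulxP [].
Qed.

Lemma mem_cosetE (W : zmodType) (H S A : set W) (y : W) :
  is_subgroup H -> cosets H S A -> A y -> A = [set y + h | h in H].
Proof.
move=> subH [x _ <-] [h Hh <-]; apply/(coset_eqP _ _ subH).
by rewrite opprD addrA subrr; case: subH => H0; apply.
Qed.

Lemma coset_xget (W : zmodType) (H S A : set W) (y : W) :
  is_subgroup H -> cosets H S A -> A (xget y A).
Proof.
by move=> [H0 _] [x _ <-]; apply: (@xgetPex _ y); exists x, 0; rewrite ?addr0.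
Qed.

(* The points ((r3, r2), (A, (r1, B))) of [data n] index the ideals of index p^n;
   they are nested so that [ncard_dep_pair] peels off one sum of E at a time. *)
Definition data3 n (r : nat * nat) (A : set Zp) (r1 : nat) :
    set (set (Zp * Zp)) :=
  [set B | S3bar alpha beta r1 r.2 r.1 (Defs.repr A) B /\ (r1 + r.2 + r.1)%N = n].

Definition data2 n r A : set (nat * set (Zp * Zp)) :=
  [set x | Cset alpha beta r.2 r.1 (Defs.repr A) x.1 /\ data3 n r A x.1 x.2].

Definition data1 n (r : nat * nat) : set (set Zp * (nat * set (Zp * Zp))) :=
  [set x | S2bar alpha beta r.2 r.1 x.1 /\ data2 n r x.1 x.2].

Definition data n : set ((nat * nat) * (set Zp * (nat * set (Zp * Zp)))) :=
  [set x | setT x.1 /\ data1 n x.1 x.2].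

Definition ideal_of_data
    (x : (nat * nat) * (set Zp * (nat * set (Zp * Zp)))) : set R :=
  of_coords @` hermite x.2.2.1 x.1.2 x.1.1 (Defs.repr x.2.1) (xget 0 x.2.2.2).

(** By [hermite_eqP] equal ideals have equal exponents and congruent representatives, and a coset is
    determined by any of its elements. *)
Lemma ideal_of_data_inj n : {in data n &, injective ideal_of_data}.
Proof.
move=> [[r3 r2] [A [r1 B]]] [[s3 s2] [A' [s1 B']]].
move=> /set_mem[_ [/= SA [_ [/= SB _]]]] /set_mem[_ [/= SA' [_ [/= SB' _]]]].
move=> /image_of_coords_inj /hermite_eqP[/= e1 e2 e3 AA' BB'].
subst s1 s2 s3.
have pA := ppow_ideal_subgroup r3.
have eA : A = A'.
  rewrite (mem_cosetE pA SA (coset_xget 0 pA SA)).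
  rewrite [in RHS](mem_cosetE pA SA' (coset_xget 0 pA SA')).
  exact/(coset_eqP _ _ pA).
subst A'; congr (_, (_, (_, _))).
have pB := lat_subgroup r2 r3 (Defs.repr A).
rewrite (mem_cosetE pB SB (coset_xget 0 pB SB)).
rewrite [in RHS](mem_cosetE pB SB' (coset_xget 0 pB SB')).
exact/(coset_eqP _ _ pB).
Qed.

Lemma image_ideal_of_data n :
  ideal_of_data @` data n = full_ideals_of_index R (p ^ n)%N.
Proof.
apply/seteqP; split=> [_ [[[r3 r2] [A [r1 B]]] [_ [/= SA [_ [/= SB <-]]]] <-]|I].
  have pA := ppow_ideal_subgroup r3.
  have pB := lat_subgroup r2 r3 (Defs.repr A).
  have S2A : S2 alpha beta r2 r3 (Defs.repr A).
    have [a S2a aE] := SA.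
    apply: S2_coset S2a; apply/(coset_eqP _ _ pA); rewrite aE.
    exact: mem_cosetE pA SA (coset_xget 0 pA SA).
  have S3B : S3 alpha beta r1 r2 r3 (Defs.repr A) (xget 0 B).
    have [u S3u uE] := SB.
    apply: S3_coset S2A S3u; first by rewrite subrr; case: pA.
    apply/(coset_eqP _ _ pB); rewrite uE.
    exact: mem_cosetE pB SB (coset_xget 0 pB SB).
  split; last by have [] := hermite_index r1 r2 r3 (Defs.repr A) (xget 0 B).
  by apply/full_idealP; exists r1, r2, r3, (Defs.repr A), (xget 0 B).
move=> [/full_idealP [r1 [r2 [r3 [a [u [S2a S3u ->]]]]]]].
have [_ ->] := hermite_index r1 r2 r3 a u.
move=> /(expnI (prime_gt1 p_pr)) rn.
have pA := ppow_ideal_subgroup r3.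
pose A := [set a + h | h in ppow_ideal r3].
have SA : S2bar alpha beta r2 r3 A by exists a.
have aA : ppow_ideal r3 (a - Defs.repr A).
  apply/(coset_eqP _ _ pA).
  exact: mem_cosetE pA SA (coset_xget 0 pA SA).
have pB := lat_subgroup r2 r3 (Defs.repr A).
(* [B] is formed with the representative of [A], not with [a] itself; [S3_coset] moves the condition
   on [u] from one to the other. *)
pose B := [set u + h | h in lat r2 r3 (Defs.repr A)].
have SB : S3bar alpha beta r1 r2 r3 (Defs.repr A) B.
  exists u => //; apply: S3_coset S2a S3u => //.
  by rewrite subrr; case: pB.
have uB : lat r2 r3 (Defs.repr A) (u - xget 0 B).
  apply/(coset_eqP _ _ pB).
  exact: mem_cosetE pB SB (coset_xget 0 pB SB).
exists ((r3, r2), (A, (r1, B))).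
  by split=> //; split=> //; split=> //; exists B.
by congr (_ @` _); apply/esym/hermite_eqP.
Qed.

(** The exponents are at most n and the other entries can be taken as natural numbers below p^n, so
    six integers below [N] determine the ideal. *)
Lemma finite_full_ideals_of_index n :
  finite_set (full_ideals_of_index R (p ^ n)%N).
Proof.
pose N := (p ^ n + n).+1.
pose g (t : 'I_N * 'I_N * 'I_N * 'I_N * 'I_N * 'I_N) : set R :=
  let: (r1, r2, r3, k, i, j) := t in
  of_coords @` hermite r1 r2 r3 k%:R (i%:R, j%:R).
apply: (@sub_finite_set _ _ (g @` setT)); last exact: finite_image.
move=> I [/full_idealP [r1 [r2 [r3 [a [u [_ _ ->]]]]]]].
have [_ ->] := hermite_index r1 r2 r3 a u.
move=> /(expnI (prime_gt1 p_pr)) rn.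
have [k kr ak] := ppow_ideal_residue r3 a.
have [i ir [y _ yE]] := ppow_ideal_residue r2 u.1.
(* Reducing [u.1] subtracts [y] times row 2, which shifts the last entry by [y * k] before it is
   reduced in turn. *)
have [j jr [z _ zE]] := ppow_ideal_residue r3 (u.2 - y * k%:R).
have pN r m : (r <= n)%N -> (m < p ^ r)%N -> (m < N)%N.
  move=> rn' mr; rewrite ltnS ltnW // (leq_trans mr) //.
  by rewrite (leq_trans _ (leq_addr _ _)) // leq_exp2l ?prime_gt1.
have nN r : (r <= n)%N -> (r < N)%N.
  by move=> rn'; rewrite ltnS (leq_trans rn') // leq_addl.
have r1N : (r1 < N)%N by apply: nN; lia.
have r2N : (r2 < N)%N by apply: nN; lia.
have r3N : (r3 < N)%N by apply: nN; lia.
have kN : (k < N)%N by apply: pN kr; lia.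
have iN : (i < N)%N by apply: pN ir; lia.
have jN : (j < N)%N by apply: pN jr; lia.
exists (Ordinal r1N, Ordinal r2N, Ordinal r3N,
  Ordinal kN, Ordinal iN, Ordinal jN) => //.
congr (_ @` _); apply/esym/hermite_eqP; split=> //.
exists y, z; rewrite (mulrC y (P r2)) (mulrC z) yE zE.
transitivity (u.1 - i%:R, u.2 - j%:R) => //.
by congr (_, _); ring.
Qed.

(** The ideals are counted by their data, and [ncard_dep_pair] splits off the sums over r, [A] and
    r1; each fibre inherits finiteness from the set of ideals. *)
Lemma zeta_coef_sum n :
  zeta_coef R (p ^ n)%N =
  \sum_(r \in [set: nat * nat]) E_coef p_pr alpha beta r.2 r.1 n.
Proof.
have fdata : finite_set (data n).
  rewrite -(eq_finite_set (inj_card_eq (@ideal_of_data_inj n))).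
  by rewrite image_ideal_of_data; apply: finite_full_ideals_of_index.
have fdata1 r : finite_set (data1 n r).
  apply: sub_finite_set (finite_image snd fdata) => x dx; by exists (r, x).
have fdata2 r A : S2bar alpha beta r.2 r.1 A -> finite_set (data2 n r A).
  move=> SA; apply: sub_finite_set (finite_image snd (fdata1 r)) => x dx.
  by exists (A, x).
rewrite /zeta_coef -image_ideal_of_data ncard_image; last exact: ideal_of_data_inj.
rewrite ncard_dep_pair //; apply: eq_fsbigr => r _.
rewrite ncard_dep_pair; last exact: fdata1.
rewrite /E_coef; apply: eq_fsbigr => A /set_mem SA.
rewrite ncard_dep_pair; last exact: fdata2.
(* The innermost fibre is all of [S3bar] when the exponents sum to n, and empty otherwise. *)
apply: eq_fsbigr => r1 _; case: eqP => [rn|rn].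
  by rewrite muln1; congr ncard; apply/seteqP; split=> [B []|B].
rewrite muln0 (_ : data3 _ _ _ _ = set0) ?ncard_set0 //.
by apply/seteqP; split=> B // [].
Qed.

(** Confines the support of the sum over pairs to a finite box and to nonempty S(r2, r3). *)
Lemma E_coef_neq0 r2 r3 n : E_coef p_pr alpha beta r2 r3 n <> 0%N ->
  (S2 alpha beta r2 r3 : set Zp) !=set0 /\ (r2 + r3 <= n)%N.
Proof.
apply: contra_notP => /not_andP nz; apply: fsbig1 => A SA; apply: fsbig1 => r1 _.
case: eqP => [rn|]; last by rewrite muln0.
case: nz => [[]|[]]; first by case: SA => a S2a _; exists a.
by rewrite -rn -addnA leq_addl.
Qed.

(** If r2 were smaller than both [beta - alpha] and r3, then p^r2 + a(beta - alpha) and a(beta -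
    alpha) would lie in p^(r2+1) Z_p, hence p^r2 as well. *)
Lemma S2_nonempty r2 r3 : alpha <> beta -> (S2 alpha beta r2 r3 : set Zp) !=set0 ->
  (vp ((beta - alpha)%:~R : Zp) <= r2)%N \/ (r3 <= r2)%N.
Proof.
move=> ab [a S2a]; apply/orP; rewrite -implyNb -!ltnNge; apply/implyP => r2d.
have d0 : ((beta - alpha)%:~R : Zp) != 0.
  apply/eqP => /(@Zloc_intr_inj _ p_pr _ 0) /eqP.
  by rewrite subr_eq0 eq_sym => /eqP.
rewrite leqNgt; apply/negP => r23.
suff : ppow_ideal r2.+1 (P r2) by move=> /ppow_ideal_le; rewrite ltnn.
have sub r : (r2 < r)%N -> ppow_ideal r `<=` (ppow_ideal r2.+1 : set Zp).
  by move=> rr x [t _ <-]; rewrite mulrC; apply/ppow_idealM/ppow_ideal_pexpr.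
rewrite -(addrK (a * (b_ - a_)) (P r2)); apply: ppow_idealD; first exact: (sub r3).
apply/ppow_idealN/ppow_idealM/(sub _ r2d); rewrite -vp_range //.
by exists 1; rewrite // mulr1 rmorphB.
Qed.

End Parametrization.

(** * Summation over the regions R_1, ..., R_6 *)

Lemma sum_regions (va vd n : nat) (G : nat * nat -> nat) :
    (forall r, G r <> 0%N -> (r.2 + r.1 <= n)%N) ->
    (forall r, G r <> 0%N -> (vd <= r.2)%N \/ (r.1 <= r.2)%N) ->
  \sum_(r \in [set: nat * nat]) G r =
  \sum_(1 <= i < 7) \sum_(r \in region va vd i) G r.
Proof.
move=> Gn Gd; pose D := fset_set (`I_n.+1 `*` `I_n.+1).
have GD r : r \notin D -> G r = 0%N.
  rewrite in_fset_set; last exact: finite_setX.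
  move=> rD; apply: contrapT => /Gn rn; move/negP: rD; apply.
  by rewrite inE; split=> /=; lia.
rewrite (fsbigTE D) //.
(* With indicators over the common finite box [D], the sums can be exchanged, and it remains to see
   that each supporting pair lies in exactly one region. *)
transitivity (\sum_(1 <= i < 7) \sum_(r <- D)
    patch (fun=> 0%N) (region va vd i) G r); last first.
  apply: eq_bigr => i _; rewrite fsbig_mkcond (fsbigTE D) // => r rD.
  by rewrite /patch GD // if_same.
rewrite exchange_big; apply: eq_bigr => r _ /=.
have [G0|/eqP/Gd] := eqVneq (G r) 0%N.
  by rewrite big1 // => i _; rewrite /patch G0 if_same.
case: r => r3 r2 /= S2r.
rewrite 6?big_ltn // big_geq // /patch.
have -> : ((r3, r2) \in region va vd 1) = (vd + va <= r2)%N && (vd + va <= r3)%N.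
  by apply/idP/andP; rewrite inE.
have -> : ((r3, r2) \in region va vd 2) =
    [&& vd <= r3, vd <= r2 & r2 < minn (vd + va) r3]%N.
  by apply/idP/and3P; rewrite inE.
have -> : ((r3, r2) \in region va vd 3) =
    [&& va <= r3, r3 < vd + va & r3 + va <= r2]%N.
  by apply/idP/and3P; rewrite inE.
have -> : ((r3, r2) \in region va vd 4) =
    [&& 0 <= r3, r3 < va & va + r3 <= r2]%N.
  by apply/idP/and3P; rewrite inE.
have -> : ((r3, r2) \in region va vd 5) = [&& 0 <= r3, r3 <= r2 & r2 < va]%N.
  by apply/idP/and3P; rewrite inE.
have -> : ((r3, r2) \in region va vd 6) =
    [&& 0 <= r3, r3 < vd + va, maxn va r3 <= r2 & r2 < va + r3]%N.
  by apply/idP/and4P; rewrite inE.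
move: (G _) => g; rewrite /GRing.add /GRing.zero /=.
(* For r3 >= vd + va the pair is in R_1 or R_2. For r3 < vd + va, r2 < r3 gives R_2, r2 >= r3 + va
   gives R_3 or R_4, and the remaining pairs are split into R_5 and R_6 at r2 = va. *)
do 6 case: ifP; lia.
Qed.

Theorem theorem3p7 (p : nat) (p_pr : prime p) (alpha beta : int)
  (alpha_neq0 : alpha <> 0) (beta_neq0 : beta <> 0) (alpha_neq_beta : alpha <> beta)
  (v_eq : vp (alpha%:~R : Zloc p_pr) = vp (beta%:~R : Zloc p_pr))
  (v_le : (vp (beta%:~R : Zloc p_pr) <= vp ((beta - alpha)%:~R : Zloc p_pr))%N) :
  let R := Rcubic p_pr alpha beta in
  (* zeta_R is a formal power series in p^{-s} with finite coefficients *)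
  (forall I : set R, full_ideal I -> exists n : nat, ideal_index I = (p ^ n)%N) /\
  (forall n : nat, finite_set (full_ideals_of_index R (p ^ n)%N)) /\
  (* equality of the coefficients of p^{-sn} *)
  (forall n : nat,
     zeta_coef R (p ^ n)%N =
     \sum_(1 <= i < 7)
       \sum_(r \in region (vp (alpha%:~R : Zloc p_pr))
                          (vp ((beta - alpha)%:~R : Zloc p_pr)) i)
         E_coef p_pr alpha beta r.2 r.1 n).
Proof.
move=> R; split=> [I /full_idealP [r1 [r2 [r3 [a [u [_ _ ->]]]]]]|].
  by exists (r1 + r2 + r3)%N; have [] := hermite_index alpha beta r1 r2 r3 a u.
split=> n; first exact: finite_full_ideals_of_index.
rewrite zeta_coef_sum; apply: (@sum_regions _ _ n) => -[r3 r2] /E_coef_neq0[] //=.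
by move=> S2r _; apply: S2_nonempty S2r.
Qed.
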